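(* Let $n>16$ be an integer and let $z$ be a positive rational number with $nz-(z+1)^2>0$. Suppose that the elliptic curve $$E_{n,z}:\ Y^2=X\Big(X^2+\big(nz(nz-2z^2-8z-2)+(z^2-1)^2\big)X+16nz^3(z+1)^2\Big)$$ has a rational point $P=(X,Y)$ (with $X,Y\in\mathbb{Q}$) satisfying $$X<0,\qquad -\frac{X\big(X-2z(nz+(z+1)^2)\big)}{2z}<Y<\big((z+1)^2-nz\big)X.$$ Then the equation $$n=(x+y+z+1)\left(\frac1x+\frac1y+\frac1z+1\right)$$ has a solution $(x,y,z)$ in positive rational numbers, with this given value of $z$ (that is, there exist positive rational numbers $x,y$ satisfying it); i.e., $n$ can be represented as the product of the sum of four positive integers with the sum of their reciprocals: there exist positive integers $a,b,c,d$ with $$n=(a+b+c+d)\left(\frac1a+\frac1b+\frac1c+\frac1d\right).$$ *)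

(* Defs.v *)
From mathcomp Require Import all_boot all_order all_algebra.

Set Implicit Arguments.
Unset Strict Implicit.
Unset Printing Implicit Defensive.

Import Order.TTheory GRing.Theory Num.Theory.
Local Open Scope ring_scope.

Definition curve_coef2 (n : int) (z : rat) : rat :=
  n%:~R * z * (n%:~R * z - 2 * z ^+ 2 - 8 * z - 2) + (z ^+ 2 - 1) ^+ 2.

Definition curve_coef1 (n : int) (z : rat) : rat :=
  16 * n%:~R * z ^+ 3 * (z + 1) ^+ 2.

(* Affine rational points of E_{n,z}; the point at infinity is left out.
   For n > 16 and z > 0 rational the cubic has nonzero discriminant, so being
   an elliptic curve needs no separate hypothesis. *)
Definition on_curve (n : int) (z X Y : rat) : Prop :=
  Y ^+ 2 = X * (X ^+ 2 + curve_coef2 n z * X + curve_coef1 n z).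

(* Main.v *)
(* With s = x + y, p = x y and c = n z - (z + 1)^2, the equation reads
   p (c - (z + 1) s) = z s (s + z + 1), so a solution in x, y amounts to an s
   making s^2 - 4 p a square.  This quartic in s has the rational root s = 0;
   sending it to infinity through s = 4 z (z + 1) c / (4 z (z + 1)^2 - X) gives
   E_{n,z}, with (x - y) / (x + y) = Y / (c X).  When X < 0 both s and p are
   positive, hence so are x and y; four integers are then obtained by clearing
   denominators, the equation being homogeneous of degree 0. *)
Require Import Defs.
From mathcomp Require Import all_boot all_order all_algebra.
From mathcomp Require Import ring lra.

Set Implicit Arguments.
Unset Strict Implicit.
Unset Printing Implicit Defensive.

Import Order.TTheory GRing.Theory Num.Theory.
Local Open Scope ring_scope.

Lemma sum_prod_gt0 (F : realDomainType) (x y : F) :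
  0 < x + y -> 0 < x * y -> 0 < x /\ 0 < y.
Proof.
move=> s_gt0 p_gt0; have [x_gt0|x_le0] := ltP 0 x.
  by split=> //; rewrite -(pmulr_rgt0 _ x_gt0).
(* If [x <= 0], then [x * y > 0] forces [y < 0], against [x + y > 0]. *)
nra.
Qed.

Lemma neg_point_solution (F : realFieldType) (n z X Y : F) :
    0 < z -> 0 < n * z - (z + 1) ^+ 2 -> X < 0 ->
    Y ^+ 2 = X * (X ^+ 2 + (n * z * (n * z - 2 * z ^+ 2 - 8 * z - 2)
                            + (z ^+ 2 - 1) ^+ 2) * X
                  + 16 * n * z ^+ 3 * (z + 1) ^+ 2) ->
  exists x y : F,
    [/\ 0 < x, 0 < y & n = (x + y + z + 1) * (x^-1 + y^-1 + z^-1 + 1)].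
Proof.
move=> z_gt0; set c := n * z - _ => c_gt0 X_lt0 curveXY.
have z_neq0 : z != 0 by rewrite gt_eqF.
(* Trades [n] for [c], which then becomes a free positive parameter. *)
have nE : n = (c + (z + 1) ^+ 2) / z by rewrite /c; field.
clearbody c.
have c_neq0 : c != 0 by rewrite gt_eqF.
have X_neq0 : X != 0 by rewrite lt_eqF.
have z1_gt0 : 0 < z + 1 by lra.
pose d := 4 * z * (z + 1) ^+ 2 - X.
have d_gt0 : 0 < d.
  have : 0 < z * (z + 1) ^+ 2 by rewrite mulr_gt0 ?exprn_gt0.
  rewrite /d; lra.
have d_neq0 : d != 0 by rewrite gt_eqF.
have e_gt0 : 0 < d + 4 * z * c by rewrite addr_gt0 ?mulr_gt0.
pose s := 4 * z * (z + 1) * c / d.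
(* Solves the equation for [p]: here [c - (z + 1) * s = - c * X / d], positive since [X < 0]. *)
pose p := 4 * z ^+ 2 * (z + 1) ^+ 2 * (d + 4 * z * c) / (- X * d).
have s_gt0 : 0 < s by rewrite divr_gt0 ?mulr_gt0.
have p_gt0 : 0 < p by rewrite divr_gt0 ?mulr_gt0 ?exprn_gt0 ?oppr_gt0.
pose r := Y / (c * X).
pose x := s * (1 + r) / 2; pose y := s * (1 - r) / 2.
have xDy : x + y = s by rewrite /x /y; field.
(* c^2 X - (X^2 + coef2 X + coef1) factors as - d (d + 4 z c). *)
have r2 : r ^+ 2 = 1 + d * (d + 4 * z * c) / (c ^+ 2 * X).
  by rewrite /r expr_div_n curveXY nE /d; field; rewrite c_neq0 X_neq0 z_neq0.
(* The value in [r2] equals [1 - 4 * p / s ^+ 2]. *)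
have xMy : x * y = p.
  have -> : x * y = s ^+ 2 * (1 - r ^+ 2) / 4 by rewrite /x /y; field.
  by rewrite r2 /s /p; field; rewrite d_neq0 X_neq0.
have [||x_gt0 y_gt0] := @sum_prod_gt0 _ x y; rewrite ?xDy ?xMy //.
exists x, y; split=> //.
have -> : x^-1 + y^-1 = s / p.
  by rewrite -xDy -xMy; field; rewrite !gt_eqF.
(* Eliminating [X] leaves a rational identity in independent [z], [c], [d]. *)
have XE : X = 4 * z * (z + 1) ^+ 2 - d by rewrite /d; ring.
rewrite xDy nE /p /s XE; field.
by rewrite -XE ?z_neq0 ?d_neq0 ?X_neq0 ?gt_eqF.
Qed.

Lemma rat_clear_denom (x : rat) (N : int) :
  0 < x -> 0 < N -> (denq x %| N)%Z -> exists2 a : int, 0 < a & a%:~R = x * N%:~R.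
Proof.
move=> x_gt0 N_gt0 /dvdzP[k NE]; exists (numq x * k).
  by rewrite mulr_gt0 ?numq_gt0 // -(pmulr_lgt0 _ (denq_gt0 x)) -NE.
by rewrite NE !intrM numqE mulrAC mulrA.
Qed.

Theorem theorem1p1 (n : int) (z : rat)
    (hn : 16 < n) (hz : 0 < z)
    (hnz : 0 < n%:~R * z - (z + 1) ^+ 2)
    (hE : exists X Y : rat,
        [/\ on_curve n z X Y,
            X < 0,
            - (X * (X - 2 * z * (n%:~R * z + (z + 1) ^+ 2)) / (2 * z)) < Y
          & Y < ((z + 1) ^+ 2 - n%:~R * z) * X]) :
  (exists x y : rat,
      [/\ 0 < x, 0 < y
        & n%:~R = (x + y + z + 1) * (x^-1 + y^-1 + z^-1 + 1)]) /\
  (exists a b c d : int,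
      [/\ 0 < a, 0 < b, 0 < c, 0 < d
        & n%:~R = (a%:~R + b%:~R + c%:~R + d%:~R) *
                  (a%:~R^-1 + b%:~R^-1 + c%:~R^-1 + d%:~R^-1) :> rat]).
Proof.
have [X [Y [curveXY X_lt0 _ _]]] := hE.
have [x [y [x_gt0 y_gt0 nE]]] := neg_point_solution hz hnz X_lt0 curveXY.
split; first by exists x, y.
pose N := denq x * denq y * denq z.
have N_gt0 : 0 < N by rewrite !mulr_gt0.
have [|a a_gt0 aE] := rat_clear_denom x_gt0 N_gt0.
  by rewrite /N -mulrA dvdz_mulr.
have [|b b_gt0 bE] := rat_clear_denom y_gt0 N_gt0.
  by rewrite /N mulrAC dvdz_mull.
have [|c c_gt0 cE] := rat_clear_denom hz N_gt0.
  by rewrite dvdz_mull.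
(* Scaling [(x, y, z, 1)] by the common denominator turns the entry 1 into [N]. *)
exists a, b, c, N; split=> //.
have N_neq0 : N%:~R != 0 :> rat by rewrite intr_eq0 gt_eqF.
by rewrite aE bE cE nE; field; rewrite N_neq0 !gt_eqF.
Qed.
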